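(* Let $B$ be a bialgebra over a field $k$, let $\mathcal{R}$ be an idempotent radical class of $\mathbf{Coalg}\text{-}B$, and let $C$ be a right $B$-module coalgebra. The following statements are equivalent: (i) $C$ is an $\mathcal{R}$-coalgebra (i.e. $C\in\mathcal{R}$). (ii) There exists an $\mathcal{R}$-subcoalgebra $C'$ of $C$ which contains the coradical $C_0$ of $C$. (iii) For every simple subcoalgebra $D$ of $C$, $DB$ is an $\mathcal{R}$-subcoalgebra of $C$.
   Context: All algebras and coalgebras are over a field $k$ and $\otimes=\otimes_k$. A (right) $B$-module coalgebra is a coalgebra $C$ which is a right $B$-module such that $\Delta:C\to C\otimes C$ and $\varepsilon:C\to k$ are $B$-module maps ($C\otimes C$ with the diagonal $B$-action, $k$ the trivial module). $\mathbf{Coalg}\text{-}B$ is the category of right $B$-module coalgebras. A $B$-submodule coalgebra of $C$ is a subcoalgebra invariant under the $B$-action. $DB$ is the $B$-submodule of $C$ generated by $D$. For subspaces $X,Y\subseteq C$, $X\wedge Y=\Delta^{-1}(X\otimes C+C\otimes Y)$. For a collection $\mathcal{R}$ of $B$-module coalgebras, a member of $\mathcal{R}$ is called an $\mathcal{R}$-coalgebra, and a $B$-submodule coalgebra of $C$ which is a member of $\mathcal{R}$ is called an $\mathcal{R}$-subcoalgebra of $C$. A non-empty collection $\mathcal{R}$ of objects of $\mathbf{Coalg}\text{-}B$ is a radical class if: (R1) every $B$-submodule coalgebra of an $\mathcal{R}$-coalgebra is an $\mathcal{R}$-coalgebra; (R2) for any $C\in\mathbf{Coalg}\text{-}B$ and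 any family $\{C_i\}_{i\in I}$ of $\mathcal{R}$-subcoalgebras of $C$, $\sum_{i\in I}C_i\in\mathcal{R}$. It is idempotent if moreover: (R3) for any $C\in\mathbf{Coalg}\text{-}B$ and any $\mathcal{R}$-subcoalgebras $C_1,C_2$ of $C$, $C_1\wedge C_2\in\mathcal{R}$. *)

(* Defs.v *)
From HB Require Import structures.
From mathcomp Require Import all_boot all_order all_algebra.
From mathcomp Require Import boolp classical_sets.

Set Implicit Arguments.
Unset Strict Implicit.
Unset Printing Implicit Defensive.

Import GRing.Theory.
Local Open Scope classical_set_scope.
Local Open Scope ring_scope.
Local Open Scope quotient_scope.

Reserved Notation "x ⊗ y" (at level 40, left associativity).

Notation bilinear_map f := (bilinear_for *:%R *:%R f).

Section TensorType.
Variables (k : fieldType) (V W : lmodType k).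

Definition formal_sum (U : lmodType k) (f : V -> W -> U) (s : seq (V * W)) : U :=
  \sum_(p <- s) f p.1 p.2.

(* Two formal sums of pairs represent the same tensor when no bilinear map
   separates them. [tlift_tens], [tlift_linear] and [tlift_unique] below are the
   universal property of the quotient. *)
Definition tensor_eqv (s t : seq (V * W)) : bool :=
  `[< forall (U : lmodType k) (f : V -> W -> U),
        bilinear_map f -> formal_sum f s = formal_sum f t >].

Lemma tensor_eqv_refl : reflexive tensor_eqv.
Proof. by move=> s; apply/asboolP. Qed.

Lemma tensor_eqv_sym : symmetric tensor_eqv.
Proof. by move=> s t; apply/asboolP/asboolP => h U f hf; rewrite h. Qed.

Lemma tensor_eqv_trans : transitive tensor_eqv.
Proof.
by move=> t s u /asboolP h /asboolP h'; apply/asboolP => U f hf; rewrite h ?h'.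
Qed.

Canonical tensor_equiv :=
  EquivRel tensor_eqv tensor_eqv_refl tensor_eqv_sym tensor_eqv_trans.

Definition tensor : Type := {eq_quot tensor_eqv}.
HB.instance Definition _ := Choice.on tensor.

Definition tens (v : V) (w : W) : tensor := \pi_{eq_quot tensor_eqv} [:: (v, w)].

(* Meaningful for bilinear [f], in which case it does not depend on the chosen
   representative. *)
Definition tlift (U : lmodType k) (f : V -> W -> U) (t : tensor) : U :=
  formal_sum f (repr (t : {eq_quot tensor_eqv})).

Definition tensor_zero : tensor := \pi_{eq_quot tensor_eqv} [::].
Definition tensor_add (s t : tensor) : tensor :=
  \pi_{eq_quot tensor_eqv} (repr (s : {eq_quot tensor_eqv}) ++
                            repr (t : {eq_quot tensor_eqv})).
Definition tensor_scale (a : k) (t : tensor) : tensor :=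
  \pi_{eq_quot tensor_eqv} [seq (a *: p.1, p.2) | p <- repr (t : {eq_quot tensor_eqv})].
Definition tensor_opp (t : tensor) : tensor := tensor_scale (-1) t.

Section Lift.
Variables (U : lmodType k) (f : V -> W -> U) (hf : bilinear_map f).

Lemma tlift_pi s : tlift f (\pi_{eq_quot tensor_eqv} s) = formal_sum f s.
Proof.
rewrite /tlift; case: piP => t /eqmodP /asboolP h; by rewrite h.
Qed.

Lemma bilinear_mapZl a v w : f (a *: v) w = a *: f v w.
Proof.
have f0 : f 0 w = 0.
  by have /= := hf.1 w (-1) 0 0; rewrite scaler0 addr0 scaleN1r addNr.
by have /= := hf.1 w a v 0; rewrite addr0 f0 addr0.
Qed.

Lemma tlift_zero : tlift f tensor_zero = 0.
Proof. by rewrite tlift_pi /formal_sum big_nil. Qed.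

Lemma tlift_add s t : tlift f (tensor_add s t) = tlift f s + tlift f t.
Proof. by rewrite tlift_pi /formal_sum big_cat. Qed.

Lemma tlift_scale a t : tlift f (tensor_scale a t) = a *: tlift f t.
Proof.
rewrite tlift_pi /formal_sum big_map scaler_sumr.
by apply: eq_bigr => p _; rewrite bilinear_mapZl.
Qed.

Lemma tlift_opp t : tlift f (tensor_opp t) = - tlift f t.
Proof. by rewrite tlift_scale scaleN1r. Qed.

Lemma tlift_tens v w : tlift f (tens v w) = f v w.
Proof. by rewrite tlift_pi /formal_sum big_seq1. Qed.

End Lift.

Lemma tensorP (s t : tensor) :
  (forall (U : lmodType k) (f : V -> W -> U), bilinear_map f ->
     tlift f s = tlift f t) -> s = t.
Proof.
move=> h; rewrite -[s]reprK -[t]reprK; apply/eqmodP/asboolP => U f hf.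
by have := h U f hf.
Qed.

Lemma tensor_addA : associative tensor_add.
Proof. by move=> x y z; apply: tensorP => U f hf; rewrite !tlift_add // addrA. Qed.
Lemma tensor_addC : commutative tensor_add.
Proof. by move=> x y; apply: tensorP => U f hf; rewrite !tlift_add // addrC. Qed.
Lemma tensor_add0 : left_id tensor_zero tensor_add.
Proof.
by move=> x; apply: tensorP => U f hf; rewrite tlift_add // tlift_zero // add0r.
Qed.
Lemma tensor_addN : left_inverse tensor_zero tensor_opp tensor_add.
Proof.
move=> x; apply: tensorP => U f hf.
by rewrite tlift_add // tlift_opp // tlift_zero // addNr.
Qed.

HB.instance Definition _ :=
  GRing.isZmodule.Build tensor tensor_addA tensor_addC tensor_add0 tensor_addN.

Lemma tensor_scaleA a b t :
  tensor_scale a (tensor_scale b t) = tensor_scale (a * b) t.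
Proof. by apply: tensorP => U f hf; rewrite !tlift_scale // scalerA. Qed.
Lemma tensor_scale1 : left_id 1 tensor_scale.
Proof. by move=> x; apply: tensorP => U f hf; rewrite tlift_scale // scale1r. Qed.
Lemma tensor_scaleDr : right_distributive tensor_scale +%R.
Proof.
move=> a x y; apply: tensorP => U f hf.
by rewrite tlift_scale // !tlift_add // !tlift_scale // scalerDr.
Qed.
Lemma tensor_scaleDl t : {morph tensor_scale^~ t : a b / a + b}.
Proof.
move=> a b; apply: tensorP => U f hf.
by rewrite tlift_add // !tlift_scale // scalerDl.
Qed.

HB.instance Definition _ := GRing.Zmodule_isLmodule.Build k tensor
  tensor_scaleA tensor_scale1 tensor_scaleDr tensor_scaleDl.

End TensorType.

Notation "V ⊗ W" := (tensor V%type W%type) : type_scope.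
Notation "v ⊗ w" := (tens v w) : ring_scope.

Section TensorTheory.
Variable k : fieldType.
Implicit Types U V W X Y Z A : lmodType k.

Lemma tens_bilinear V W : bilinear_map (@tens k V W).
Proof.
by split=> [w a v v'|v a w w'] /=; apply: tensorP => U f hf;
  rewrite tlift_add // tlift_scale // !tlift_tens // ?hf.1 ?hf.2.
Qed.

Lemma tlift_linear V W U (f : V -> W -> U) :
  bilinear_map f -> linear (tlift f).
Proof. by move=> hf a s t; rewrite tlift_add // tlift_scale. Qed.

Lemma tensor_sum V W (t : V ⊗ W) :
  t = \sum_(p <- repr (t : {eq_quot @tensor_eqv k V W})) p.1 ⊗ p.2.
Proof.
apply: tensorP => U f hf; rewrite {1}/tlift /formal_sum.
elim: (repr t) => [|p s IH]; first by rewrite !big_nil tlift_zero.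
by rewrite !big_cons tlift_add // tlift_tens // IH.
Qed.

Lemma linear_sum_fun V W (g : V -> W) : linear g ->
  forall (I : Type) (r : seq I) (F : I -> V),
    g (\sum_(i <- r) F i) = \sum_(i <- r) g (F i).
Proof.
move=> hg I r F.
have g0 : g 0 = 0.
  by have /= := hg (-1) 0 0; rewrite scaler0 addr0 scaleN1r addNr.
elim: r => [|i r IH]; first by rewrite !big_nil.
by rewrite !big_cons -IH -[F i]scale1r hg !scale1r.
Qed.

Lemma linear_tensor_ext V W U (g h : V ⊗ W -> U) : linear g -> linear h ->
  (forall v w, g (v ⊗ w) = h (v ⊗ w)) -> forall t, g t = h t.
Proof.
move=> hg hh e t; rewrite [t]tensor_sum !linear_sum_fun //.
by apply: eq_bigr.
Qed.

Lemma tlift_unique V W U (f : V -> W -> U) (g : V ⊗ W -> U) :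
  bilinear_map f -> linear g -> (forall v w, g (v ⊗ w) = f v w) ->
  forall t, g t = tlift f t.
Proof.
move=> hf hg e; apply: linear_tensor_ext => // [|v w]; first exact: tlift_linear.
by rewrite e tlift_tens.
Qed.

Definition tmap V W X Y (f : V -> X) (g : W -> Y) : V ⊗ W -> X ⊗ Y :=
  tlift (fun v w => f v ⊗ g w).

Definition tassoc U V W : (U ⊗ V) ⊗ W -> U ⊗ (V ⊗ W) :=
  tlift (fun t w => tlift (fun u v => u ⊗ (v ⊗ w)) t).

(* (v ⊗ w, a ⊗ a') |-> f v a ⊗ g w a' *)
Definition tmap2 V W A A' X Y (f : V -> A -> X) (g : W -> A' -> Y)
    (t : V ⊗ W) (s : A ⊗ A') : X ⊗ Y :=
  tlift (fun v w => tlift (fun a a' => f v a ⊗ g w a') s) t.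

Lemma tmap_bilinear V W X Y (f : V -> X) (g : W -> Y) :
  linear f -> linear g -> bilinear_map (fun v w => f v ⊗ g w).
Proof.
move=> hf hg; split=> [w a v v'|v a w w'] /=.
  by rewrite hf (tens_bilinear _ _).1.
by rewrite hg (tens_bilinear _ _).2.
Qed.

Lemma tmap_linear V W X Y (f : V -> X) (g : W -> Y) :
  linear f -> linear g -> linear (tmap f g).
Proof. by move=> hf hg; apply/tlift_linear/tmap_bilinear. Qed.

Lemma tmapE V W X Y (f : V -> X) (g : W -> Y) : linear f -> linear g ->
  forall v w, tmap f g (v ⊗ w) = f v ⊗ g w.
Proof. by move=> hf hg v w; rewrite /tmap tlift_tens //; apply: tmap_bilinear. Qed.

Lemma linear_comp V W U (g : W -> U) (f : V -> W) :
  linear g -> linear f -> linear (g \o f).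
Proof. by move=> hg hf a x y /=; rewrite hf hg. Qed.

Lemma linear_id V : linear (@id V). Proof. by []. Qed.

Lemma tmap_comp V W X Y X' Y' (f : V -> X) (g : W -> Y) (f' : X -> X')
    (g' : Y -> Y') : linear f -> linear g -> linear f' -> linear g' ->
  forall t, tmap f' g' (tmap f g t) = tmap (f' \o f) (g' \o g) t.
Proof.
move=> hf hg hf' hg'; apply: linear_tensor_ext => [||v w].
- by apply: (@linear_comp _ _ _ (tmap f' g') (tmap f g)); apply: tmap_linear.
- by apply: tmap_linear; apply: linear_comp.
- by rewrite !tmapE //; apply: linear_comp.
Qed.

Lemma tmap_id V W (t : V ⊗ W) : tmap id id t = t.
Proof.
move: t; apply: (@linear_tensor_ext _ _ _ (tmap id id) id) => //.
- exact: tmap_linear.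
- by move=> v w; rewrite tmapE.
Qed.

Lemma tassoc_bilinear1 U V W (w : W) :
  bilinear_map (fun (u : U) (v : V) => u ⊗ (v ⊗ w)).
Proof.
split=> [v a u u'|u a v v'] /=; first by rewrite (tens_bilinear _ _).1.
by rewrite (tens_bilinear _ _).1 (tens_bilinear _ _).2.
Qed.

Lemma tassoc_bilinear U V W :
  bilinear_map (fun (t : U ⊗ V) (w : W) => tlift (fun u v => u ⊗ (v ⊗ w)) t).
Proof.
split=> [w|t a w w'] /=; first by apply: tlift_linear; apply: tassoc_bilinear1.
rewrite {1}/tlift /formal_sum.
rewrite [in RHS]/tlift /formal_sum scaler_sumr -big_split /=.
apply: eq_bigr => p _.
by rewrite (tens_bilinear _ _).2 (tens_bilinear _ _).2.
Qed.

Lemma tassoc_linear U V W : linear (@tassoc U V W).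
Proof. exact/tlift_linear/tassoc_bilinear. Qed.

Lemma tassocE U V W (u : U) (v : V) (w : W) :
  tassoc ((u ⊗ v) ⊗ w) = u ⊗ (v ⊗ w).
Proof.
rewrite /tassoc tlift_tens; last exact: tassoc_bilinear.
by rewrite tlift_tens //; apply: tassoc_bilinear1.
Qed.

Lemma tlift_fun_linear V W U (f g h : V -> W -> U) (a : k) :
  (forall v w, f v w = a *: g v w + h v w) ->
  forall t, tlift f t = a *: tlift g t + tlift h t.
Proof.
move=> e t; rewrite /tlift /formal_sum scaler_sumr -big_split /=.
by apply: eq_bigr.
Qed.

Section Tmap2.
Variables (V W A A' X Y : lmodType k) (f : V -> A -> X) (g : W -> A' -> Y).
Hypotheses (hf : bilinear_map f) (hg : bilinear_map g).

Lemma tmap2_inner v w : bilinear_map (fun a a' => f v a ⊗ g w a').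
Proof. by apply: tmap_bilinear; [exact: hf.2 | exact: hg.2]. Qed.

Lemma tmap2_outer s :
  bilinear_map (fun v w => tlift (fun a a' => f v a ⊗ g w a') s).
Proof.
split=> [w c v v'|v c w w'] /=; apply: tlift_fun_linear => a a'.
  by rewrite hf.1 (tens_bilinear _ _).1.
by rewrite hg.1 (tens_bilinear _ _).2.
Qed.

Lemma tmap2_bilinear : bilinear_map (tmap2 f g).
Proof.
split=> [s|t c s s'] /=; first exact/tlift_linear/tmap2_outer.
by apply: tlift_fun_linear => v w; apply/tlift_linear/tmap2_inner.
Qed.

Lemma tmap2E v w a a' : tmap2 f g (v ⊗ w) (a ⊗ a') = f v a ⊗ g w a'.
Proof.
rewrite /tmap2 tlift_tens; last exact: tmap2_outer.
by rewrite tlift_tens //; apply: tmap2_inner.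
Qed.

End Tmap2.

End TensorTheory.

Section Subspaces.
Variable k : fieldType.

Definition is_subspace (V : lmodType k) (D : set V) : Prop :=
  D 0 /\ forall (a : k) (x y : V), D x -> D y -> D (a *: x + y).

Definition lspan (V : lmodType k) (A : set V) : set V :=
  smallest (@is_subspace V) A.

(* The canonical image of X ⊗ Y in V ⊗ W. *)
Definition tensor_sub (V W : lmodType k) (X : set V) (Y : set W) : set (V ⊗ W) :=
  lspan [set t | exists x y, [/\ X x, Y y & t = x ⊗ y]].

End Subspaces.

HB.mixin Record Lmodule_isCoalgebra (k : fieldType) C of GRing.Lmodule k C := {
  comul : {linear C -> (C ⊗ C)%type};
  counit : {scalar C};
  comulA : forall c : C, tassoc (tmap comul id (comul c)) = tmap id comul (comul c);
  counitl : forall c : C, tlift (fun x y : C => counit x *: y) (comul c) = c;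
  counitr : forall c : C, tlift (fun x y : C => counit y *: x) (comul c) = c
}.

#[short(type="coalgType")]
HB.structure Definition Coalgebra (k : fieldType) :=
  {C of GRing.Lmodule k C & Lmodule_isCoalgebra k C}.

(* The product of B ⊗ B is [tmap2 *%R *%R]. *)
HB.mixin Record isBialgebra (k : fieldType) B
    of GRing.Algebra k B & Coalgebra k B := {
  comulM : forall a b : B,
    comul (a * b) = tmap2 *%R *%R (comul a) (comul b) :> B ⊗ B;
  comul1 : comul (1 : B) = 1 ⊗ 1;
  counitM : forall a b : B, counit (a * b) = counit a * counit b;
  counit1 : counit (1 : B) = 1
}.

#[short(type="bialgType")]
HB.structure Definition Bialgebra (k : fieldType) :=
  {B of GRing.Algebra k B & Coalgebra k B & isBialgebra k B}.

(* Right modules: [act c b] is c·b. The diagonal action on C ⊗ C is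
   (t, b) |-> [tmap2 act act t (comul b)]. *)
HB.mixin Record isModuleCoalgebra (k : fieldType) (B : bialgType k) C
    of Coalgebra k C := {
  act : C -> B -> C;
  act_bilinear : bilinear_map act;
  act1 : forall c : C, act c 1 = c;
  actM : forall (c : C) (a b : B), act c (a * b) = act (act c a) b;
  comul_act : forall (c : C) (b : B),
    comul (act c b) = tmap2 act act (comul c) (comul b) :> C ⊗ C;
  counit_act : forall (c : C) (b : B), counit (act c b) = counit c * counit b
}.

#[short(type="modCoalgType")]
HB.structure Definition ModuleCoalgebra (k : fieldType) (B : bialgType k) :=
  {C of Coalgebra k C & isModuleCoalgebra k B C}.

Section Subobjects.
Variables (k : fieldType).

Definition is_subcoalg (C : coalgType k) (D : set C) : Prop :=
  is_subspace D /\ forall x, D x -> tensor_sub D D (comul x).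

Definition is_simple_subcoalg (C : coalgType k) (D : set C) : Prop :=
  [/\ is_subcoalg D, D <> [set 0] &
      forall E : set C, is_subcoalg E -> E `<=` D -> E = [set 0] \/ E = D].

Definition coradical (C : coalgType k) : set C :=
  lspan (\bigcup_(D in @is_simple_subcoalg C) D).

Definition wedge (C : coalgType k) (X Y : set C) : set C :=
  comul @^-1` lspan (tensor_sub X [set: C] `|` tensor_sub [set: C] Y).

Variable B : bialgType k.

Definition is_submod (C : modCoalgType B) (D : set C) : Prop :=
  is_subspace D /\ forall (x : C) (b : B), D x -> D (act x b).

Definition submod_gen (C : modCoalgType B) (D : set C) : set C :=
  smallest (@is_submod C) D.

Definition is_submodcoalg (C : modCoalgType B) (D : set C) : Prop :=
  is_subcoalg D /\ is_submod D.

End Subobjects.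

Section Retraction.
Variables (k : fieldType) (V : lmodType k) (D : set V).
Hypothesis hD : is_subspace D.

Lemma subspace_scale a x : D x -> D (a *: x).
Proof. by move=> h; rewrite -[_ *: _]addr0; apply: hD.2 => //; apply: hD.1. Qed.

Lemma subspace_add x y : D x -> D y -> D (x + y).
Proof. by move=> hx hy; rewrite -[x]scale1r; apply: hD.2. Qed.

Lemma subspace_sub x y : D x -> D y -> D (x - y).
Proof. by move=> hx hy; rewrite addrC -scaleN1r; apply: hD.2. Qed.

Lemma subspace_complement : exists M : set V,
  [/\ is_subspace M, forall x, M x -> D x -> x = 0
    & forall v, exists d m, [/\ D d, M m & v = d + m]].
Proof.
pose P (M : set V) := (forall a x y, M x -> M y -> M (a *: x + y)) /\
                      (forall x, M x -> D x -> x = 0).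
have [F FP tot|M [[Mlin MD] Mmax]] := @Zorn_bigcup V P.
  split=> [a x y [X FX Xx] [Y FY Yy]|x [X FX Xx]]; last exact: (FP _ FX).2.
  have [XY|YX] := tot _ _ FX FY.
    by exists Y => //; apply: (FP _ FY).1 => //; apply: XY.
  by exists X => //; apply: (FP _ FX).1 => //; apply: YX.
have M0 : M 0.
  apply: contrapT => nM0; apply: (Mmax [set 0]).
    split=> [x Mx|h]; last by apply: nM0; apply: h.
    exfalso; apply: nM0; have := Mlin (-1) x x Mx Mx.
    by rewrite scaleN1r addNr.
  split=> [a x y /= -> ->|x /= -> //]; by rewrite scaler0 addr0.
have hM : is_subspace M by split.
exists M; split=> // v; apply: contrapT => nv.
pose N := [set x | exists a m, M m /\ x = a *: v + m].
apply: (Mmax N).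
  split=> [m Mm|NM]; first by exists 0, m; rewrite scale0r add0r.
  apply: nv; exists 0, v; rewrite add0r; split=> //; first exact: hD.1.
  by apply: NM; exists 1, 0; rewrite scale1r addr0.
split=> [a x y [b [m [Mm ->]]] [c [n [Mn ->]]]|x [a [m [Mm ->]]] Dx].
  exists (a * b + c), (a *: m + n); split; first exact: Mlin.
  by rewrite scalerDr scalerA scalerDl addrACA.
have [a0|a0] := eqVneq a 0.
  by move: Dx; rewrite a0 scale0r add0r => Dm; exact: MD.
exfalso; apply: nv; exists (a^-1 *: (a *: v + m)), (- (a^-1 *: m)); split.
- exact: subspace_scale.
- by rewrite -scaleNr -[_ *: _]addr0; apply: Mlin.
- by rewrite scalerDr scalerA mulVf // scale1r addrK.
Qed.

Lemma subspace_retraction : exists r : V -> V,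
  [/\ linear r, forall x, D (r x) & forall x, D x -> r x = x].
Proof.
have [M [hM MD ex]] := subspace_complement.
have {ex} ex v : {d | exists m, [/\ D d, M m & v = d + m]} by apply: cid.
pose r v := sval (ex v).
have Dr v : D (r v) by rewrite /r; case: (ex v) => d [m []].
have rE v d m : D d -> M m -> v = d + m -> r v = d.
  move=> Dd Mm vE; rewrite /r; case: (ex v) => d' [m' [Dd' Mm' /= vE']].
  apply/eqP; rewrite -subr_eq0; apply/eqP; apply: MD; last exact: subspace_sub.
  have -> : d' - d = m - m'.
    by apply/eqP; rewrite subr_eq addrAC eq_sym subr_eq addrC -vE vE'.
  by rewrite addrC -scaleN1r; apply: hM.2.
have rM v : M (v - r v).
  by rewrite /r; case: (ex v) => d [m [Dd Mm /= ->]]; rewrite addrC addKr.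
exists r; split=> // [a x y|x Dx]; last first.
  by apply: (rE _ _ 0) => //; [exact: hM.1 | rewrite addr0].
apply: (rE _ _ (a *: (x - r x) + (y - r y))).
- exact: hD.2.
- exact: hM.2.
- by rewrite addrACA -scalerDr !(addrC (r _)) !subrK.
Qed.

End Retraction.

Section SubModuleCoalgebra.
Variables (k : fieldType) (B : bialgType k) (C : modCoalgType B) (D : set C).
Hypothesis hD : is_submodcoalg D.

Definition sub_carrier of is_submodcoalg D : Type := {x : C | x \in D}.
Local Notation S := (sub_carrier hD).

HB.instance Definition _ := SubType.on S.
HB.instance Definition _ := Choice.on S.

Lemma sub_carrier_closed : subsemimod_closed (fun x : C => x \in D).
Proof.
have [[hs _] _] := hD.
have inD x : (x \in (fun x : C => x \in D)) = (x \in D) by [].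
split; first split.
- by rewrite inD; apply: mem_set; apply: hs.1.
- move=> x y; rewrite !inD => /set_mem hx /set_mem hy.
  by apply: mem_set; apply: subspace_add.
- by move=> a x; rewrite !inD => /set_mem hx; apply: mem_set; apply: subspace_scale.
Qed.

HB.instance Definition _ :=
  GRing.SubChoice_isSubLmodule.Build k C (fun x : C => x \in D) S sub_carrier_closed.

Definition sub_incl (x : S) : C := \val x.

Lemma sub_incl_linear : linear sub_incl.
Proof. by move=> a x y; rewrite /sub_incl linearP. Qed.

Lemma sub_incl_inj : injective sub_incl. Proof. exact: val_inj. Qed.

Lemma sub_inclP x : D (sub_incl x). Proof. exact/set_mem/(valP x). Qed.

Lemma sub_retraction_ex : exists r : C -> S, linear r /\ cancel sub_incl r.
Proof.
have [r [rl rD rid]] := subspace_retraction hD.1.1.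
exists (fun x => exist _ (r x) (mem_set (rD x)) : S); split=> [a x y|x].
  apply: sub_incl_inj; rewrite sub_incl_linear; exact: rl.
by apply: sub_incl_inj; apply: rid; apply: sub_inclP.
Qed.

Definition sub_retr : C -> S := sval (cid sub_retraction_ex).

Lemma sub_retr_linear : linear sub_retr.
Proof. by rewrite /sub_retr; case: cid => r []. Qed.

Lemma sub_inclK : cancel sub_incl sub_retr.
Proof. by rewrite /sub_retr; case: cid => r []. Qed.

(* The unique map that agrees with the comultiplication of C along the inclusion
   ([tmap_incl_comul] and [tmap_incl_inj]): the retraction is only a means to
   write it down. *)
Definition sub_comul (x : S) : S ⊗ S := tmap sub_retr sub_retr (comul (sub_incl x)).

Let il := sub_incl_linear.
Let rl := sub_retr_linear.

Lemma tmap_incl_inj : injective (tmap sub_incl sub_incl).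
Proof.
apply: (@can_inj _ _ _ (tmap sub_retr sub_retr)) => t; rewrite tmap_comp //.
rewrite -[RHS]tmap_id; congr (tmap _ _ t); apply/funext => x; exact: sub_inclK.
Qed.

Lemma tensor_sub_incl (t : C ⊗ C) : tensor_sub D D t ->
  tmap sub_incl sub_incl (tmap sub_retr sub_retr t) = t.
Proof.
pose Q : set (C ⊗ C) :=
  [set t | tmap sub_incl sub_incl (tmap sub_retr sub_retr t) = t].
suff: tensor_sub D D `<=` Q by exact.
apply: smallest_sub.
  split=> [|a x y]; rewrite /Q /=.
    have z : forall (U W : lmodType k) (g : U -> W), linear g -> g 0 = 0.
      by move=> U W g hg; have /= := hg (-1) 0 0; rewrite scaler0 addr0 scaleN1r addNr.
    by rewrite !z //; apply: tmap_linear.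
  by move=> hx hy; rewrite (tmap_linear rl rl) (tmap_linear il il) hx hy.
move=> _ [x [y [Dx Dy ->]]]; rewrite /Q /= !tmapE //.
have e z : D z -> sub_incl (sub_retr z) = z.
  move=> Dz; pose z' : S := exist _ z (mem_set Dz).
  by have -> : z = sub_incl z' by []; rewrite sub_inclK.
by rewrite !e.
Qed.

Lemma tmap_incl_comul (x : S) :
  tmap sub_incl sub_incl (sub_comul x) = comul (sub_incl x).
Proof. by apply: tensor_sub_incl; apply: hD.1.2; apply: sub_inclP. Qed.

Lemma sub_comul_linear : linear sub_comul.
Proof.
move=> a x y; rewrite /sub_comul il linearP; exact: (tmap_linear rl rl).
Qed.

HB.instance Definition _ := GRing.isLinear.Build k S (S ⊗ S)%type *:%R sub_comul
  sub_comul_linear.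

Definition sub_counit (x : S) : k := counit (sub_incl x).

Lemma sub_counit_linear : scalar sub_counit.
Proof. by move=> a x y; rewrite /sub_counit il linearP. Qed.

HB.instance Definition _ := GRing.isLinear.Build k S k *%R sub_counit
  sub_counit_linear.

Lemma comul_linear : linear (comul : C -> C ⊗ C).
Proof. by move=> a x y; rewrite linearP. Qed.

Lemma sub_comulA (c : S) :
  tassoc (tmap sub_comul id (sub_comul c)) = tmap id sub_comul (sub_comul c).
Proof.
pose i2 := tmap sub_incl sub_incl; have i2l : linear i2 by apply: tmap_linear.
have cl := comul_linear; have scl := sub_comul_linear.
apply: (@can_inj _ _ (tmap sub_incl i2)
         (tmap sub_retr (tmap sub_retr sub_retr))).
  move=> t; rewrite tmap_comp //; last exact: tmap_linear.
  rewrite -[RHS]tmap_id; congr (tmap _ _ t); apply/funext => x /=.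
    exact: sub_inclK.
  rewrite /i2 tmap_comp // -[RHS]tmap_id; congr (tmap _ _ x).
    by apply/funext => y; apply: sub_inclK.
  by apply/funext => y; apply: sub_inclK.
have -> t : tmap sub_incl i2 (tassoc t) = tassoc (tmap i2 sub_incl t).
  move: t; apply: linear_tensor_ext.
  - apply: (@linear_comp _ _ _ _ (tmap sub_incl i2)); first exact: tmap_linear.
    exact: tassoc_linear.
  - apply: (@linear_comp _ _ _ _ _ (tmap i2 sub_incl)); first exact: tassoc_linear.
    exact: tmap_linear.
  - move=> t w; rewrite tmapE //; move: t.
    apply: linear_tensor_ext.
    + move=> a x y; rewrite (tens_bilinear _ _).1 (@tassoc_linear k).
      by rewrite (tmap_linear il i2l).
    + by move=> a x y; rewrite i2l (tens_bilinear _ _).1 (@tassoc_linear k).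
    + move=> u v; rewrite tassocE tmapE // /i2 !tmapE //.
      by rewrite tassocE.
have eC x : i2 (sub_comul x) = comul (sub_incl x) by exact: tmap_incl_comul.
have -> : tmap i2 sub_incl (tmap sub_comul id (sub_comul c)) =
          tmap comul id (comul (sub_incl c)).
  rewrite -eC (tmap_comp scl (@linear_id _ _) i2l il).
  rewrite (tmap_comp il il cl (@linear_id _ _)).
  by congr (tmap _ _ _); apply/funext => x; exact: eC.
have -> : tmap sub_incl i2 (tmap id sub_comul (sub_comul c)) =
          tmap id comul (comul (sub_incl c)).
  rewrite -eC (tmap_comp (@linear_id _ _) scl il i2l).
  rewrite (tmap_comp il il (@linear_id _ _) cl).
  by congr (tmap _ _ _); apply/funext => x; exact: eC.
exact: comulA.
Qed.

Lemma sub_counit_law (f : C -> C -> C) (g : S -> S -> S) (c : S) :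
  bilinear_map f -> bilinear_map g ->
  (forall x y, sub_incl (g x y) = f (sub_incl x) (sub_incl y)) ->
  tlift f (comul (sub_incl c)) = sub_incl c -> tlift g (sub_comul c) = c.
Proof.
move=> hf hg fg fc; apply: sub_incl_inj; rewrite -[RHS]fc -tmap_incl_comul.
move: (sub_comul c); apply: linear_tensor_ext.
- by apply: (@linear_comp _ _ _ _ sub_incl) => //; apply: tlift_linear.
- apply: (@linear_comp _ _ _ _ _ (tmap sub_incl sub_incl)).
    exact: tlift_linear.
  exact: tmap_linear.
- by move=> v w; rewrite tmapE // !tlift_tens.
Qed.

Lemma counitl_bilinear (E : lmodType k) (e : E -> k) : scalar e ->
  bilinear_map (fun x y : E => e x *: y).
Proof.
move=> he; split=> [y a x x'|x a y y'] /=.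
  by rewrite he scalerDl scalerA.
by rewrite scalerDr !scalerA mulrC.
Qed.

Lemma counitr_bilinear (E : lmodType k) (e : E -> k) : scalar e ->
  bilinear_map (fun x y : E => e y *: x).
Proof.
move=> he; split=> [y a x x'|x a y y'] /=.
  by rewrite scalerDr !scalerA mulrC.
by rewrite he scalerDl scalerA.
Qed.

Lemma counit_linear : scalar (counit : C -> k).
Proof. by move=> a x y; rewrite linearP. Qed.

Lemma sub_counitl (c : S) :
  tlift (fun x y : S => sub_counit x *: y) (sub_comul c) = c.
Proof.
apply: (@sub_counit_law (fun x y => counit x *: y)).
- exact: counitl_bilinear counit_linear.
- exact: counitl_bilinear sub_counit_linear.
- by move=> x y; rewrite /sub_incl linearZ.
- exact: counitl.
Qed.

Lemma sub_counitr (c : S) :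
  tlift (fun x y : S => sub_counit y *: x) (sub_comul c) = c.
Proof.
apply: (@sub_counit_law (fun x y => counit y *: x)).
- exact: counitr_bilinear counit_linear.
- exact: counitr_bilinear sub_counit_linear.
- by move=> x y; rewrite /sub_incl linearZ.
- exact: counitr.
Qed.

HB.instance Definition _ :=
  Lmodule_isCoalgebra.Build k S sub_comulA sub_counitl sub_counitr.

Definition sub_act (x : S) (b : B) : S :=
  exist _ (act (sub_incl x) b) (mem_set (hD.2.2 _ b (sub_inclP x))).

Lemma sub_actE x b : sub_incl (sub_act x b) = act (sub_incl x) b.
Proof. by []. Qed.

Lemma sub_act_bilinear : bilinear_map sub_act.
Proof.
split=> [b a x y|x a b b'] /=; apply: sub_incl_inj.
  by rewrite il !sub_actE il act_bilinear.1.
by rewrite il !sub_actE act_bilinear.2.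
Qed.

Lemma sub_act1 x : sub_act x 1 = x.
Proof. by apply: sub_incl_inj; rewrite sub_actE act1. Qed.

Lemma sub_actM x a b : sub_act x (a * b) = sub_act (sub_act x a) b.
Proof. by apply: sub_incl_inj; rewrite !sub_actE actM. Qed.

Lemma sub_comul_act x b :
  sub_comul (sub_act x b) = tmap2 sub_act sub_act (sub_comul x) (comul b).
Proof.
apply: tmap_incl_inj; rewrite tmap_incl_comul sub_actE comul_act.
rewrite -tmap_incl_comul; set i2 := tmap _ _.
have i2l : linear i2 by exact: tmap_linear.
have ab : bilinear_map (act : C -> B -> C) by exact: act_bilinear.
have [tl tr] := tmap2_bilinear ab ab.
have [sl sr] := tmap2_bilinear sub_act_bilinear sub_act_bilinear.
move: (sub_comul x); apply: linear_tensor_ext.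
- by apply: (@linear_comp _ _ _ _ (fun t => tmap2 act act t (comul b)) i2).
- by apply: (@linear_comp _ _ _ _ i2).
- move=> v w; move: (comul b); apply: linear_tensor_ext => [||a a'].
  + exact: tr.
  + by apply: (@linear_comp _ _ _ _ i2) => //; exact: sr.
  + rewrite /= (tmap2E sub_act_bilinear sub_act_bilinear) /i2.
    by rewrite !(tmapE il il) (tmap2E ab ab).
Qed.

Lemma sub_counit_act x b : sub_counit (sub_act x b) = sub_counit x * counit b.
Proof. by rewrite /sub_counit sub_actE counit_act. Qed.

HB.instance Definition _ := isModuleCoalgebra.Build k B S sub_act_bilinear
  sub_act1 sub_actM sub_comul_act sub_counit_act.

End SubModuleCoalgebra.

Arguments coradical {k} C _.

Section RadicalClasses.
Variables (k : fieldType) (B : bialgType k).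

Definition sub_modcoalg (C : modCoalgType B) (D : set C)
  (hD : is_submodcoalg D) : modCoalgType B := sub_carrier hD.

(* As a set of elements, the improper submodule coalgebra of C is C itself. As a
   type, [sub_modcoalg] of it is {x : C | x \in setT}, which is only canonically
   isomorphic to C; [coalg_class_full] is the resulting trace of equality (and of
   invariance under isomorphism), and no further closure is assumed. *)
Record coalg_class := CoalgClass {
  coalg_class_mem :> modCoalgType B -> Prop;
  coalg_class_full : forall (C : modCoalgType B) (hC : is_submodcoalg [set: C]),
    coalg_class_mem (sub_modcoalg hC) -> coalg_class_mem C
}.

Definition is_Rsubcoalg (R : coalg_class) (C : modCoalgType B) (D : set C) : Prop :=
  exists hD : is_submodcoalg D, R (sub_modcoalg hD).

Record radical_class (R : coalg_class) : Prop := {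
  radical_nonempty : exists C : modCoalgType B, R C;
  radical_sub : forall (C : modCoalgType B) (D : set C),
    R C -> is_submodcoalg D -> is_Rsubcoalg R D;
  radical_sum : forall (C : modCoalgType B) (I : Type) (D : I -> set C),
    (forall i, is_Rsubcoalg R (D i)) -> is_Rsubcoalg R (lspan (\bigcup_i D i))
}.

Record idempotent_radical_class (R : coalg_class) : Prop := {
  idempotent_radical :> radical_class R;
  idempotent_wedge : forall (C : modCoalgType B) (X Y : set C),
    is_Rsubcoalg R X -> is_Rsubcoalg R Y -> is_Rsubcoalg R (wedge X Y)
}.

End RadicalClasses.

(* Main.v *)
Require Import Defs.
From HB Require Import structures.
From mathcomp Require Import all_boot all_order all_algebra.
From mathcomp Require Import boolp classical_sets.

(* Let X be the sum of all R-subcoalgebras of C; it is closed under the wedge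
   product, and the point is that a wedge-closed subcoalgebra X containing every
   simple subcoalgebra is all of C. Otherwise pick a finite-dimensional left
   C*-submodule N of C, minimal among those not contained in X, so that N/(N ∩ X)
   is a simple module. A nonzero coefficient of this module generates a
   finite-dimensional subcoalgebra, which contains a simple subcoalgebra E. By
   density, if the ideal of functionals vanishing on E did not kill N/(N ∩ X), it
   would contain an element acting as the identity, hence agreeing with the counit
   on E, which is absurd. So functionals vanishing on E, in particular those
   vanishing on X, send N into X; that is, N lies in X ∧ X = X. *)

Set Implicit Arguments.
Unset Strict Implicit.
Unset Printing Implicit Defensive.

Import GRing.Theory.
Local Open Scope classical_set_scope.
Local Open Scope ring_scope.

(** * Separating functionals and finite-dimensional subspaces *)

Section LinearAlgebra.
Variable k : fieldType.
Implicit Type V : lmodType k.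

Definition scalar_of V (f : V -> k) (hf : scalar f) : {scalar V} :=
  HB.pack f (GRing.isLinear.Build k V k *%R f hf).

Lemma scalar_ofE V (f : V -> k) (hf : scalar f) x : scalar_of hf x = f x.
Proof. by []. Qed.

Lemma is_subspace_lspan V (A : set V) : is_subspace (lspan A).
Proof.
split=> [|a x y hx hy] M [hM AM]; first exact: hM.1.
by apply: hM.2; [apply: hx | apply: hy].
Qed.

Lemma sub_lspan V (A : set V) : A `<=` lspan A.
Proof. exact: sub_smallest. Qed.

Lemma lspan_sub V (A M : set V) : is_subspace M -> A `<=` M -> lspan A `<=` M.
Proof. exact: smallest_sub. Qed.

Lemma lspan_subset V (A A' : set V) : A `<=` A' -> lspan A `<=` lspan A'.
Proof.
move=> s; apply: lspan_sub; first exact: is_subspace_lspan.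
by move=> x /s; apply: sub_lspan.
Qed.

Lemma is_subspace_sum V (M : set V) : is_subspace M ->
  forall (T : Type) (r : seq T) (F : T -> V),
  (forall i, M (F i)) -> M (\sum_(i <- r) F i).
Proof.
move=> hM T r F h; elim/big_ind: _ => // [|x y]; first exact: hM.1.
exact: subspace_add.
Qed.

(** Modulo a retraction onto [X], [v] becomes the nonzero vector [w]; a retraction onto the line
    through [w] then gives the coordinate [f]. *)
Lemma scalar_separates V (X : set V) (v : V) : is_subspace X -> ~ X v ->
  exists f : {scalar V}, (forall x, X x -> f x = 0) /\ f v = 1.
Proof.
move=> hX nv; have [r [rl rX rid]] := subspace_retraction hX.
pose w := v - r v.
have w0 : w != 0.
  apply/eqP => /subr0_eq e; apply: nv; rewrite e; exact: rX.
pose L : set V := [set x | exists a, x = a *: w].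
have hL : is_subspace L.
  split; first by exists 0; rewrite scale0r.
  by move=> a _ _ [b ->] [c ->]; exists (a * b + c); rewrite scalerDl scalerA.
have [p [pl pL pid]] := subspace_retraction hL.
pose g x := p (x - r x).
have gl : linear g by move=> a x y; rewrite /g -pl rl scalerBr opprD addrACA.
pose f x := projT1 (cid (pL (x - r x))).
have fE x : g x = f x *: w by rewrite /f; case: cid.
have finj a b : a *: w = b *: w -> a = b.
  move/eqP; rewrite -subr_eq0 -scalerBl scaler_eq0 (negPf w0) orbF subr_eq0.
  by move/eqP.
have fl : scalar f.
  by move=> a x y; apply: finj; rewrite -fE gl !fE scalerDl scalerA.
exists (scalar_of fl); split=> [x Xx|] /=; apply: finj; rewrite -fE /g.
  rewrite rid // subrr scale0r.
  by have /= := pl (-1) 0 0; rewrite scaler0 addr0 scaleN1r addNr.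
by rewrite scale1r; apply: pid; exists 1; rewrite scale1r.
Qed.

Lemma scalar_eq0 V (v : V) : (forall f : {scalar V}, f v = 0) -> v = 0.
Proof.
move=> h; apply: contrapT => v0.
have [||f [_ fv]] := @scalar_separates V [set 0] v.
- by split=> // a _ _ -> ->; rewrite scaler0 addr0.
- by [].
- by have /eqP := h f; rewrite fv oner_eq0.
Qed.

(** Finite-dimensional subspaces are spans of lists, so that induction on the list stands in for
    induction on dimension. *)
Fixpoint fspan V (s : seq V) : set V :=
  if s is x :: s' then [set v | exists a, fspan s' (v - a *: x)] else [set 0].

Lemma is_subspace_fspan V (s : seq V) : is_subspace (fspan s).
Proof.
elim: s => [|x s [s0 sD]] /=.
  by split=> // a _ _ -> ->; rewrite scaler0 addr0.
split=> [|a u v [b hb] [c hc]]; first by exists 0; rewrite scale0r subr0.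
exists (a * b + c).
by rewrite scalerDl opprD addrACA -scalerA -scalerBr; apply: sD.
Qed.

Lemma fspan_subset_cons V (x : V) s : fspan s `<=` fspan (x :: s).
Proof. by move=> v h; exists 0; rewrite scale0r subr0. Qed.

Lemma fspan_mem V (s : seq V) x : x \in s -> fspan s x.
Proof.
elim: s => // y s IH; rewrite inE => /predU1P[->|/IH]; last exact: fspan_subset_cons.
by exists 1; rewrite scale1r subrr; apply: (is_subspace_fspan s).1.
Qed.

Lemma fspan_sub V (s : seq V) (M : set V) : is_subspace M ->
  (forall x, x \in s -> M x) -> fspan s `<=` M.
Proof.
move=> hM; elim: s => [|x s IH] h v /=; first by move->; exact: hM.1.
move=> [a /IH hv]; rewrite -(subrK (a *: x) v) addrC.
apply: hM.2; first by apply: h; rewrite mem_head.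
by apply: hv => y ys; apply: h; rewrite inE ys orbT.
Qed.

(** One step of Gaussian elimination: [w] has a nonzero coefficient at [x], so a multiple of it
    clears that of [v]. *)
Lemma fspan_cons_modulo V (x : V) s (W : set V) (w v : V) : is_subspace W ->
  W w -> fspan (x :: s) w -> ~ fspan s w -> W v -> fspan (x :: s) v ->
  exists b, (W `&` fspan s) (v - b *: w).
Proof.
move=> hW Ww [a ha] nw Wv [c hc].
have a0 : a != 0 by apply/eqP => a0; apply: nw; move: ha; rewrite a0 scale0r subr0.
exists (c / a); split; first by apply: subspace_sub => //; apply: subspace_scale.
have -> : v - (c / a) *: w = (- (c / a)) *: (w - a *: x) + (v - c *: x).
  rewrite scalerBr scalerA mulNr divfK // !scaleNr opprK [RHS]addrC.
  by rewrite [X in _ = _ + X]addrC addrA subrK.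
by apply: (is_subspace_fspan s).2.
Qed.

Lemma fspan_basis V (s : seq V) (W : set V) : is_subspace W -> W `<=` fspan s ->
  exists t : seq V, W = fspan t.
Proof.
elim: s W => [|x s IH] W hW Ws.
  by exists [::]; apply/seteqP; split=> // _ ->; exact: hW.1.
have hWs : is_subspace (W `&` fspan s).
  have hs := is_subspace_fspan s.
  split; first by split; [exact: hW.1 | exact: hs.1].
  by move=> a u v [? ?] [? ?]; split; [exact: hW.2 | exact: hs.2].
have [t tE] := IH _ hWs (@subIsetr _ _ _).
have [/IH|] := EM (W `<=` fspan s); first exact.
move/existsNP => [w /not_implyP[Ww nw]].
exists (w :: t); apply/seteqP; split=> v.
  by move=> Wv; rewrite /= -tE; apply: fspan_cons_modulo (Ws _ _) _ _ (Ws _ _).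
rewrite /= -tE => -[a [h _]]; rewrite -(subrK (a *: w) v) addrC.
exact: hW.2.
Qed.

(** The descending chain condition in finite dimension. The traces of members on [fspan s] are
    minimised first, by induction; members with the same trace differ by at most one dimension. *)
Lemma fspan_minimal V (s : seq V) (F : set V -> Prop) :
  (forall W, F W -> is_subspace W /\ W `<=` fspan s) -> (exists W, F W) ->
  exists W, F W /\ forall W', F W' -> W' `<=` W -> W' = W.
Proof.
elim: s F => [|x s IH] F hF [W0 FW0].
  have E W : F W -> W = [set 0].
    by move=> /hF [hW Ws]; apply/seteqP; split=> // _ ->; exact: hW.1.
  by exists W0; split=> // W' /E -> _; rewrite (E _ FW0).
have hs := is_subspace_fspan s.
pose G (Z : set V) := exists W, F W /\ Z = W `&` fspan s.
have [||Z [[W1 [FW1 Z1]] Zmin]] := IH G.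
- move=> _ [W [/hF[hW _] ->]]; split; last exact: subIsetr.
  split; first by split; [exact: hW.1 | exact: hs.1].
  by move=> a u v [? ?] [? ?]; split; [exact: hW.2 | exact: hs.2].
- by exists (W0 `&` fspan s), W0.
have Zeq W : F W -> W `&` fspan s `<=` Z -> W `&` fspan s = Z.
  by move=> FW; apply: Zmin; exists W.
(* A member with trace [Z] inside [fspan s] is the better choice. If there is none, every member
   below [W1] has a vector outside [fspan s], and elimination against it recovers [W1]. *)
have [[W2 [FW2 Z2 W2s]]|nex] :=
    EM (exists W, [/\ F W, W `&` fspan s = Z & W `<=` fspan s]).
  have W2Z : W2 = Z by rewrite -Z2; apply/esym/setIidPl.
  exists W2; split=> // W' FW' W'W.
  have W's : W' `<=` fspan s := subset_trans W'W W2s.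
  have W'I : W' `&` fspan s = W' by apply/setIidPl.
  by rewrite W2Z -(Zeq _ FW') W'I // -W2Z.
exists W1; split=> // W' FW' W'W; apply/seteqP; split=> // v W1v.
have W'Z : W' `&` fspan s = Z.
  by apply: Zeq => //; rewrite Z1; apply: setSI.
have /existsNP[w /not_implyP[W'w nw]] : ~ (W' `<=` fspan s).
  by move=> W's; apply: nex; exists W'.
have [hW1 W1s] := hF _ FW1; have [hW' _] := hF _ FW'.
have [] := fspan_cons_modulo hW1 (W'W _ W'w) (W1s _ (W'W _ W'w)) nw W1v (W1s _ W1v).
move=> b; rewrite -Z1 -W'Z => -[h _].
by rewrite -(subrK (b *: w) v) addrC; apply: hW'.2.
Qed.

End LinearAlgebra.

(** * Contracting a tensor with a functional on one factor *)

Section TensorContraction.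
Variable k : fieldType.
Implicit Types V W U A Z : lmodType k.

Lemma linear0_fun V W (g : V -> W) : linear g -> g 0 = 0.
Proof. by move=> hg; have /= := hg (-1) 0 0; rewrite scaler0 addr0 scaleN1r addNr. Qed.

Lemma linear_tlift V W U A (g : U -> A) (f : V -> W -> U) (t : (V ⊗ W)%type) :
  linear g -> g (tlift f t) = tlift (fun x y => g (f x y)) t.
Proof. by move=> hg; rewrite /tlift /formal_sum linear_sum_fun. Qed.

(** This and [contractl] are id ⊗ f and f ⊗ id, with V ⊗ k and k ⊗ W identified with V and W. *)
Definition contractr V W (f : {scalar W}) (t : (V ⊗ W)%type) : V :=
  tlift (fun x y => f y *: x) t.

Definition contractl V W (f : {scalar V}) (t : (V ⊗ W)%type) : W :=
  tlift (fun x y => f x *: y) t.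

Lemma contractr_bilinear V W (f : {scalar W}) :
  bilinear_map (fun (x : V) (y : W) => f y *: x).
Proof.
split=> [y a x x'|x a y y'] /=; last by rewrite linearP scalerDl scalerA.
by rewrite scalerDr !scalerA mulrC.
Qed.

Lemma contractl_bilinear V W (f : {scalar V}) :
  bilinear_map (fun (x : V) (y : W) => f x *: y).
Proof.
split=> [y a x x'|x a y y'] /=; first by rewrite linearP scalerDl scalerA.
by rewrite scalerDr !scalerA mulrC.
Qed.

Lemma contractr_linear V W (f : {scalar W}) : linear (@contractr V W f).
Proof. exact/tlift_linear/contractr_bilinear. Qed.

Lemma contractl_linear V W (f : {scalar V}) : linear (@contractl V W f).
Proof. exact/tlift_linear/contractl_bilinear. Qed.

Lemma contractrE V W (f : {scalar W}) (x : V) y : contractr f (x ⊗ y) = f y *: x.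
Proof. by rewrite /contractr tlift_tens //; apply: contractr_bilinear. Qed.

Lemma contractlE V W (f : {scalar V}) x (y : W) : contractl f (x ⊗ y) = f x *: y.
Proof. by rewrite /contractl tlift_tens //; apply: contractl_bilinear. Qed.

(** Both sides are (f ⊗ g)(t). *)
Lemma contract_swap V W (f : {scalar V}) (g : {scalar W}) (t : (V ⊗ W)%type) :
  f (contractr g t) = g (contractl f t).
Proof.
rewrite /contractr /contractl /tlift /formal_sum !raddf_sum.
by apply: eq_bigr => p _; rewrite /= !scalarZ mulrC.
Qed.

Lemma tensl_linear V W (y : W) : linear (fun x : V => x ⊗ y).
Proof. by move=> a x x'; rewrite (tens_bilinear _ _).1. Qed.

Lemma tensr_linear V W (x : V) : linear (fun y : W => x ⊗ y).
Proof. by move=> a y y'; rewrite (tens_bilinear _ _).2. Qed.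

Lemma is_subspace_preim V W (g : V -> W) (M : set W) :
  linear g -> is_subspace M -> is_subspace (g @^-1` M).
Proof.
move=> hg hM; split=> [|a x y hx hy] /=; first by rewrite linear0_fun //; exact: hM.1.
by rewrite hg; apply: hM.2.
Qed.

Lemma is_subspace0 V : is_subspace [set 0 : V].
Proof. by split=> // a _ _ -> ->; rewrite scaler0 addr0. Qed.

Lemma is_subspace_tensor_sub V W (X : set V) (Y : set W) :
  is_subspace (tensor_sub X Y).
Proof. exact: is_subspace_lspan. Qed.

Lemma tensor_sub_tens V W (X : set V) (Y : set W) x y :
  X x -> Y y -> tensor_sub X Y (x ⊗ y).
Proof. by move=> Xx Yy; apply: sub_lspan; exists x, y. Qed.

Lemma tensor_sub_subset V W (X X' : set V) (Y Y' : set W) :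
  X `<=` X' -> Y `<=` Y' -> tensor_sub X Y `<=` tensor_sub X' Y'.
Proof.
move=> XX YY; apply: lspan_subset => _ [x [y [Xx Yy ->]]].
by exists x, y; split=> //; [apply: XX | apply: YY].
Qed.

Lemma tensor_sub_min V W (X : set V) (Y : set W) (M : set (V ⊗ W)%type) :
  is_subspace M -> (forall x y, X x -> Y y -> M (x ⊗ y)) ->
  tensor_sub X Y `<=` M.
Proof. by move=> hM h; apply: lspan_sub => // _ [x [y [Xx Yy ->]]]; exact: h. Qed.

Lemma contractr_tensor_sub V W (X : set V) (Y : set W) (g : {scalar W})
    (t : (V ⊗ W)%type) : is_subspace X ->
  tensor_sub X Y t -> X (contractr g t).
Proof.
move=> hX; move: t; apply: (tensor_sub_min (M := contractr g @^-1` X)).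
  exact: is_subspace_preim (contractr_linear g) hX.
by move=> x y Xx _ /=; rewrite contractrE; apply: subspace_scale.
Qed.

Lemma contractl_tensor_sub V W (X : set V) (Y : set W) (f : {scalar V})
    (t : (V ⊗ W)%type) : is_subspace Y ->
  tensor_sub X Y t -> Y (contractl f t).
Proof.
move=> hY; move: t; apply: (tensor_sub_min (M := contractl f @^-1` Y)).
  exact: is_subspace_preim (contractl_linear f) hY.
by move=> x y _ Yy /=; rewrite contractlE; apply: subspace_scale.
Qed.

(** Induction on the list: when [y] is new, [t] is [x ⊗ y] plus a tensor over the shorter list, and
    a functional that kills [fspan s] but not [y] shows that [x] is 0. *)
Lemma contractr_eq0_fspan V W (s : seq W) (t : (V ⊗ W)%type) :
  tensor_sub [set: V] (fspan s) t ->
  (forall g : {scalar W}, contractr g t = 0) -> t = 0.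
Proof.
elim: s t => [|y s IH] t.
  move=> ht _; move: t ht; apply: tensor_sub_min; first exact: is_subspace0.
  by move=> x _ _ -> /=; rewrite (linear0_fun (tensr_linear x)).
have hs := is_subspace_fspan s.
have [ys|nys] := EM (fspan s y).
  move=> ht; apply: IH; move: ht; apply: tensor_sub_subset => //.
  by apply: fspan_sub => // z; rewrite inE => /predU1P[->|/fspan_mem].
pose M : set (V ⊗ W)%type :=
  [set t | exists x, tensor_sub [set: V] (fspan s) (t - x ⊗ y)].
have hM : is_subspace M.
  have hT := is_subspace_tensor_sub [set: V] (fspan s).
  split; first by exists 0; rewrite (linear0_fun (tensl_linear y)) subr0; exact: hT.1.
  move=> a u v [x hx] [x' hx']; exists (a *: x + x').
  by rewrite tensl_linear opprD addrACA -scalerBr; apply: hT.2.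
have sM : tensor_sub [set: V] (fspan (y :: s)) `<=` M.
  apply: tensor_sub_min => // x z _ [a hz]; exists (a *: x).
  have -> : (a *: x) ⊗ y = x ⊗ (a *: y).
    rewrite -[a *: x]addr0 tensl_linear (linear0_fun (tensl_linear y)).
    by rewrite -[a *: y]addr0 tensr_linear (linear0_fun (tensr_linear x)).
  have -> : x ⊗ z - x ⊗ (a *: y) = x ⊗ (z - a *: y).
    by rewrite addrC -scaleN1r -tensr_linear scaleN1r addrC.
  exact: tensor_sub_tens.
move=> /sM [x hx] h.
have [g [gs gy]] := scalar_separates hs nys.
have g0 : contractr g (t - x ⊗ y) = 0.
  move: hx; apply: (tensor_sub_min (M := contractr g @^-1` [set 0])).
    exact: is_subspace_preim (contractr_linear g) (@is_subspace0 _).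
  by move=> u v _ /gs gv /=; rewrite contractrE gv scale0r.
have x0 : x = 0.
  have /= := contractr_linear g (-1) (x ⊗ y) t.
  rewrite !scaleN1r (addrC (- _)) g0 h addr0 contractrE gy scale1r.
  by move/esym/eqP; rewrite oppr_eq0 => /eqP.
by apply: IH h; move: hx; rewrite x0 (linear0_fun (tensl_linear y)) subr0.
Qed.

Lemma contractr_eq0 V W (t : (V ⊗ W)%type) :
  (forall g : {scalar W}, contractr g t = 0) -> t = 0.
Proof.
have [s tE] : exists s : seq (V * W), t = \sum_(p <- s) p.1 ⊗ p.2.
  by eexists; exact: (tensor_sum t).
apply: (@contractr_eq0_fspan _ _ (map snd s)); rewrite {}tE big_seq.
elim/big_ind: _ => [|x y|p ps]; first exact: (is_subspace_tensor_sub _ _).1.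
  exact: (subspace_add (is_subspace_tensor_sub _ _)).
by apply: tensor_sub_tens => //; exact/fspan_mem/map_f.
Qed.

Lemma scalar_comp_linear V W (f : {scalar W}) (g : V -> W) :
  linear g -> scalar (fun x => f (g x)).
Proof. by move=> hg a x y; rewrite hg linearP. Qed.

Lemma contractr_tmap V W A Z (f : V -> A) (g : W -> Z) (h : {scalar Z})
    (hf : linear f) (hg : linear g) (t : (V ⊗ W)%type) :
  contractr h (tmap f g t) = f (contractr (scalar_of (scalar_comp_linear h hg)) t).
Proof.
move: t; apply: linear_tensor_ext => [||v w].
- apply: (@linear_comp _ _ _ _ (contractr h)); first exact: contractr_linear.
  exact: tmap_linear.
- by apply: (@linear_comp _ _ _ _ f) => //; exact: contractr_linear.
- rewrite tmapE // !contractrE /=.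
  by rewrite -[_ *: v]addr0 hf (linear0_fun hf) addr0.
Qed.

Lemma tmapDl V W A Z (f g h : V -> A) (u : W -> Z) (t : (V ⊗ W)%type) :
  (forall x, f x = g x + h x) -> tmap f u t = tmap g u t + tmap h u t.
Proof.
move=> e; rewrite -[tmap g u t]scale1r; apply: tlift_fun_linear => x y.
by rewrite e -[g x]scale1r tensl_linear !scale1r.
Qed.

Lemma tmapDr V W A Z (f g h : W -> Z) (u : V -> A) (t : (V ⊗ W)%type) :
  (forall x, f x = g x + h x) -> tmap u f t = tmap u g t + tmap u h t.
Proof.
move=> e; rewrite -[tmap u g t]scale1r; apply: tlift_fun_linear => x y.
by rewrite e -[g y]scale1r tensr_linear !scale1r.
Qed.

Lemma tensor_sub_tmap V W A Z (f : V -> A) (g : W -> Z) (D : set A) (E : set Z)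
    (t : (V ⊗ W)%type) : (forall x, D (f x)) -> (forall y, E (g y)) ->
  tensor_sub D E (tmap f g t).
Proof.
move=> fD gE; apply: is_subspace_sum (is_subspace_tensor_sub _ _) _ _ _ _ => p.
exact: tensor_sub_tens.
Qed.

Lemma subspace_projections V (X : set V) : is_subspace X ->
  exists p q : V -> V, [/\ linear p, linear q, forall x, X (p x),
    forall x, X x -> q x = 0 & forall x, x = p x + q x].
Proof.
move=> hX; have [p [pl pX pid]] := subspace_retraction hX.
exists p, (fun x => x - p x); split=> // [a x y|x Xx|x].
- by rewrite pl scalerBr opprD addrACA.
- by rewrite pid // subrr.
- by rewrite addrC subrK.
Qed.

(** This is (X ⊗ W) ∩ (V ⊗ Y) = X ⊗ Y in terms of contractions. The block [q ⊗ id] of [t] vanishes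
    because right contractions lie in [X], the block [p ⊗ q'] because left contractions lie in
    [Y]. *)
Lemma tensor_sub_contract V W (X : set V) (Y : set W) (t : (V ⊗ W)%type) :
  is_subspace X -> is_subspace Y ->
  (forall g, X (contractr g t)) -> (forall f, Y (contractl f t)) ->
  tensor_sub X Y t.
Proof.
move=> hX hY tX tY.
have [p [q [pl ql pX qX pq]]] := subspace_projections hX.
have [p' [q' [pl' ql' pY qY pq']]] := subspace_projections hY.
rewrite -[t]tmap_id (tmapDl _ _ pq) (tmapDr _ _ pq').
have -> : tmap q id t = 0.
  by apply: contractr_eq0 => g; rewrite (contractr_tmap g ql (@linear_id _ _)) qX.
have -> : tmap p q' t = 0.
  (* An outer functional [f] turns the right contraction into a left one, which [q'] kills. *)
  apply: contractr_eq0 => g; rewrite (contractr_tmap g pl ql'); apply: scalar_eq0 => f.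
  rewrite -[LHS]/(scalar_of (scalar_comp_linear f pl) _) contract_swap.
  by rewrite scalar_ofE qY // linear0.
by rewrite !addr0; apply: tensor_sub_tmap.
Qed.

(** Only the block [q ⊗ q'] has to vanish: [g] composed with [q'] kills [Y], so that contraction
    lies in [X], which [q] kills. *)
Lemma tensor_wedge_contract V W (X : set V) (Y : set W) (t : (V ⊗ W)%type) :
  is_subspace X -> is_subspace Y ->
  (forall g : {scalar W}, (forall y, Y y -> g y = 0) -> X (contractr g t)) ->
  lspan (tensor_sub X [set: W] `|` tensor_sub [set: V] Y) t.
Proof.
move=> hX hY tX.
have [p [q [pl ql pX qX pq]]] := subspace_projections hX.
have [p' [q' [pl' ql' pY qY pq']]] := subspace_projections hY.
rewrite -[t]tmap_id (tmapDl _ _ pq) (tmapDr q _ pq').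
have -> : tmap q q' t = 0.
  apply: contractr_eq0 => g; rewrite (contractr_tmap g ql ql') qX //.
  by apply: tX => y Yy /=; rewrite qY // linear0.
rewrite addr0; apply: (subspace_add (is_subspace_lspan _)).
  by apply: sub_lspan; left; apply: tensor_sub_tmap.
by apply: sub_lspan; right; apply: tensor_sub_tmap.
Qed.

End TensorContraction.

(** * Coassociativity in Sweedler form *)

Section Coassociativity.
Variables (k : fieldType) (C : coalgType k).

Lemma eq_tlift (V W U : lmodType k) (f g : V -> W -> U) (t : (V ⊗ W)%type) :
  (forall x y, f x y = g x y) -> tlift f t = tlift g t.
Proof. by move=> e; apply: eq_bigr => p _; exact: e. Qed.

(** Both sides are T(c_1, c_2, c_3): [T] induces a linear map [F] on C ⊗ (C ⊗ C), where [comulA]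
    applies. *)
Lemma coassoc_trilinear (U : lmodType k) (T : C -> C -> C -> U) (c : C) :
  (forall z, bilinear_map (fun x y => T x y z)) -> (forall x, bilinear_map (T x)) ->
  tlift (fun x z => tlift (fun x1 x2 => T x1 x2 z) (comul x)) (comul c) =
  tlift (fun x z => tlift (T x) (comul z)) (comul c).
Proof.
move=> hT hT'; pose F : (C ⊗ (C ⊗ C))%type -> U := tlift (fun x s => tlift (T x) s).
have hF : bilinear_map (fun x (s : (C ⊗ C)%type) => tlift (T x) s).
  split=> [s|x] /=; last exact: tlift_linear.
  by move=> a x x'; apply: tlift_fun_linear => y z; rewrite (hT z).1.
have Fl : linear F by exact: tlift_linear.
pose G := F \o @tassoc k C C C.
have Gl : linear G by apply: linear_comp => //; exact: tassoc_linear.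
have Ge : G (tmap comul id (comul c)) =
    tlift (fun x z => G (comul x ⊗ z)) (comul c) by exact: linear_tlift.
have Fe : F (tmap id comul (comul c)) =
    tlift (fun x z => F (x ⊗ comul z)) (comul c) by exact: linear_tlift.
transitivity (G (tmap comul id (comul c))).
  rewrite Ge; apply: eq_tlift => x z; rewrite /G /=.
  rewrite {1}/tassoc tlift_tens; last exact: tassoc_bilinear.
  rewrite (linear_tlift _ _ Fl); apply: eq_tlift => x1 x2.
  by rewrite /F !tlift_tens.
rewrite /G /= comulA Fe; apply: eq_tlift => x z.
by rewrite /F tlift_tens.
Qed.

End Coassociativity.

(** * The C*-bimodule structure of C *)

Section HitActions.
Variables (k : fieldType) (C : coalgType k).
Implicit Types (f g h : {scalar C}) (c : C).

(* The two actions of the convolution algebra C* on C: [hitl f c] is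
   f ⇀ c = c_1 f(c_2) and [hitr f c] is c ↼ f = f(c_1) c_2. *)
Definition hitl f c : C := contractr f (comul c).
Definition hitr f c : C := contractl f (comul c).

Lemma hitl_linear f : linear (hitl f).
Proof. by move=> a x y; rewrite /hitl linearP contractr_linear. Qed.

Lemma hitr_linear f : linear (hitr f).
Proof. by move=> a x y; rewrite /hitr linearP contractl_linear. Qed.

(** The convolution product, c ↦ f(c_1) g(c_2). *)
Definition conv f g : {scalar C} := scalar_of (scalar_comp_linear f (hitl_linear g)).

Lemma convEl f g c : conv f g c = f (hitl g c). Proof. by []. Qed.

Lemma hit_swap f g c : f (hitl g c) = g (hitr f c).
Proof. exact: contract_swap. Qed.

(** Both sides are c_1 f(c_2) g(c_3). *)
Lemma hitlA f g c : hitl f (hitl g c) = hitl (conv f g) c.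
Proof.
pose T x y z := g z *: (f y *: x) : C.
have hT z : bilinear_map (fun x y => T x y z).
  split=> [y a x x'|x a y y'] /=; rewrite /T.
    by rewrite !scalerDr !scalerA [X in X *: _]mulrC mulrA.
  by rewrite linearP scalerDl scalerDr !scalerA mulrCA mulrA.
have hT' x : bilinear_map (T x).
  split=> [z a y y'|y a z z'] /=; rewrite /T; last by rewrite linearP scalerDl -scalerA.
  by rewrite linearP scalerDl scalerDr !scalerA mulrCA mulrA.
have hl := hitl_linear f.
transitivity (tlift (fun x z => tlift (fun x1 x2 => T x1 x2 z) (comul x)) (comul c)).
  rewrite {2}/hitl /contractr (linear_tlift _ _ hl); apply: eq_tlift => x z.
  rewrite -[g z *: x]addr0 hl (linear0_fun hl) addr0 /hitl /contractr.
  rewrite (@linear_tlift _ _ _ _ _ (fun v => g z *: v)) // => a u v.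
  by rewrite scalerDr !scalerA mulrC.
rewrite coassoc_trilinear //; apply: eq_tlift => x z; rewrite convEl /hitl /contractr.
rewrite (@linear_tlift _ _ _ _ _ (fun v => f v *: x)) => [|a u v].
  by apply: eq_tlift => y1 y2; rewrite /T scalarZ scalerA.
by rewrite linearP scalerDl scalerA.
Qed.

Lemma eq_scalar c c' : (forall f, f c = f c') -> c = c'.
Proof.
move=> e; apply/eqP; rewrite -subr_eq0; apply/eqP/scalar_eq0 => f.
by rewrite linearB e subrr.
Qed.

(** Tested against an arbitrary functional, [hit_swap] reduces this to [hitlA]; the same works for
    [hitlrC]. *)
Lemma hitrA f g c : hitr g (hitr f c) = hitr (conv f g) c.
Proof.
by apply: eq_scalar => h; rewrite -!hit_swap convEl hitlA [RHS]hit_swap.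
Qed.

Lemma hitlrC f g c : hitl f (hitr g c) = hitr g (hitl f c).
Proof.
by apply: eq_scalar => h; rewrite -[RHS]hit_swap hitlA [RHS]hit_swap.
Qed.

Lemma hitl_counit c : hitl counit c = c. Proof. exact: counitr. Qed.
Lemma hitr_counit c : hitr counit c = c. Proof. exact: counitl. Qed.

Lemma scalar_lincomb a f g : scalar (fun x => a * f x + g x).
Proof. by move=> b x y; rewrite !linearP mulrDr mulrCA addrACA -mulrDr. Qed.

Definition lincomb a f g : {scalar C} := scalar_of (scalar_lincomb a f g).

Lemma lincombE a f g c : lincomb a f g c = a * f c + g c. Proof. by []. Qed.

Lemma hitl_lincomb a f g c : hitl (lincomb a f g) c = a *: hitl f c + hitl g c.
Proof.
by apply: tlift_fun_linear => x y; rewrite lincombE scalerDl scalerA.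
Qed.

(** Local finiteness: the left factors of one representative of [comul c] span every f ⇀ c. *)
Lemma hitl_fspan c : exists s : seq C, forall f, fspan s (hitl f c).
Proof.
have := tensor_sum (comul c); set r := repr _ => rE.
exists (map fst r) => f; rewrite /hitl rE (linear_sum_fun (contractr_linear f)) big_seq.
elim/big_ind: _ => [|x y|p pr]; first exact: (is_subspace_fspan _).1.
  exact: (subspace_add (is_subspace_fspan _)).
rewrite contractrE; apply: (subspace_scale (is_subspace_fspan _)).
exact/fspan_mem/map_f.
Qed.

Lemma hitr_fspan c : exists s : seq C, forall f, fspan s (hitr f c).
Proof.
have := tensor_sum (comul c); set r := repr _ => rE.
exists (map snd r) => f; rewrite /hitr rE (linear_sum_fun (contractl_linear f)) big_seq.
elim/big_ind: _ => [|x y|p pr]; first exact: (is_subspace_fspan _).1.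
  exact: (subspace_add (is_subspace_fspan _)).
rewrite contractlE; apply: (subspace_scale (is_subspace_fspan _)).
exact/fspan_mem/map_f.
Qed.

Lemma hitl_fspan_seq (r : seq C) :
  exists s : seq C, forall c, fspan r c -> forall f, fspan s (hitl f c).
Proof.
elim: r => [|x r [s hs]].
  by exists [::] => _ -> f; exact: linear0_fun (hitl_linear f).
have [s' hs'] := hitl_fspan x; exists (s' ++ s) => c [a hc] f.
have hss := is_subspace_fspan (s' ++ s).
have sub (u : seq C) : {subset u <= s' ++ s} -> fspan u `<=` fspan (s' ++ s).
  by move=> h; apply: fspan_sub => // y /h; exact: fspan_mem.
rewrite -(subrK (a *: x) c) addrC hitl_linear.
apply: hss.2; first by apply: sub (hs' f) => y ys; rewrite mem_cat ys.
by apply: sub (hs _ hc f) => y ys; rewrite mem_cat ys orbT.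
Qed.

Lemma hitlr_fspan c : exists s : seq C, forall f g, fspan s (hitl f (hitr g c)).
Proof.
have [r hr] := hitr_fspan c; have [s hs] := hitl_fspan_seq r.
by exists s => f g; apply: hs.
Qed.

(** Subcoalgebras are the sub-bimodules over C*, so that module theory applies to them; the converse
    rests on [tensor_sub_contract]. *)
Lemma subcoalgP (D : set C) :
  is_subcoalg D <-> [/\ is_subspace D, forall f c, D c -> D (hitl f c)
    & forall f c, D c -> D (hitr f c)].
Proof.
split=> [[hD cD]|[hD lD rD]].
  split=> // f c /cD; first exact: contractr_tensor_sub.
  exact: contractl_tensor_sub.
by split=> // c Dc; apply: tensor_sub_contract => // f; [exact: lD | exact: rD].
Qed.

End HitActions.

(** * Simple subcoalgebras and wedge-closed subcoalgebras *)

Section CoradicalWedge.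
Variables (k : fieldType) (C : coalgType k).
Implicit Types (f g h : {scalar C}) (c : C) (N D E X : set C).

Definition is_left_submod N : Prop :=
  is_subspace N /\ forall f c, N c -> N (hitl f c).

Lemma is_subspace_nonempty (V : lmodType k) (M : set V) x : M x ->
  (forall a x y, M x -> M y -> M (a *: x + y)) -> is_subspace M.
Proof.
by move=> Mx hM; split=> //; rewrite -(addNr x) -scaleN1r; apply: hM.
Qed.

Lemma hitl_null f c : hitl (lincomb (-1) f f) c = 0.
Proof. by rewrite hitl_lincomb scaleN1r addNr. Qed.

(* Density: N/(N ∩ X) is a simple C*-module not annihilated by the ideal I, so I
   acts on it through all of C*, as far as finitely many vectors can tell. *)
Lemma ideal_dense X N (I : set {scalar C}) (s : seq C) g :
  is_left_submod X -> is_left_submod N ->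
  (forall N', is_left_submod N' -> N' `<=` N -> ~ N' `<=` X -> N' = N) ->
  (forall a i j, I i -> I j -> I (lincomb a i j)) ->
  (forall f i, I i -> I (conv f i) /\ I (conv i f)) ->
  (exists i n, [/\ I i, N n & ~ X (hitl i n)]) ->
  (forall v, v \in s -> N v) ->
  exists i, I i /\ forall v, v \in s -> X (hitl i v - hitl g v).
Proof.
move=> [hX lX] [hN lN] Nmin Ilin Imul [i [n [Ii Nn nX]]].
elim: s => [|v s IH] sN; first by exists i.
have Nv : N v by apply: sN; rewrite mem_head.
have [|i0 [Ii0 i0P]] := IH; first by move=> u us; apply: sN; rewrite inE us orbT.
(* [K] is the left ideal of functionals sending the earlier vectors into [X]. The error [b] of [i0]
   belongs to it and is to be corrected at [v]. *)
pose K f := forall u, u \in s -> X (hitl f u).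
pose b := lincomb (-1) i0 g.
have bE u : hitl b u = - (hitl i0 u - hitl g u).
  by rewrite hitl_lincomb scaleN1r opprB addrC.
have XN u : X u -> X (- u) by rewrite -scaleN1r; apply: subspace_scale.
have Kb : K b by move=> u us; rewrite bE; apply/XN/i0P.
have Klin a f f' : K f -> K f' -> K (lincomb a f f').
  by move=> Kf Kf' u us; rewrite hitl_lincomb; apply: hX.2; [apply: Kf | apply: Kf'].
pose Kv : set C := [set c | exists f, K f /\ c = hitl f v].
have hKv : is_left_submod Kv.
  split=> [|f _ [f' [Kf' ->]]].
    apply: (@is_subspace_nonempty _ _ (hitl b v)); first by exists b.
    move=> a _ _ [f [Kf ->]] [f' [Kf' ->]]; exists (lincomb a f f').
    by rewrite hitl_lincomb; split=> //; apply: Klin.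
  exists (conv f f'); rewrite hitlA; split=> // u us.
  by rewrite -hitlA; apply: lX; apply: Kf'.
(* If [K] sends [v] into [X], so does [b], and [i0] needs no correction. Otherwise minimality gives
   Kv = N. *)
have [KvX|nKvX] := EM (Kv `<=` X).
  exists i0; split=> // u; rewrite inE => /predU1P[->|]; last exact: i0P.
  by rewrite -[hitl i0 v - _]opprK -bE; apply/XN/KvX; exists b.
have KvN : Kv = N by apply: Nmin => // _ [f [_ ->]]; exact: lN.
pose M := lspan [set c | exists j m, [/\ I j, N m & c = hitl j m]].
have hM : is_left_submod M.
  split=> [|f]; first exact: is_subspace_lspan.
  apply: (lspan_sub (M := hitl f @^-1` M)).
    by apply: is_subspace_preim; [exact: hitl_linear | exact: is_subspace_lspan].
  move=> _ [j [m [Ij Nm ->]]]; apply: sub_lspan; exists (conv f j), m.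
  by split=> //; [exact: (Imul f j Ij).1 | rewrite hitlA].
have MN : M = N.
  have sMN : M `<=` N by apply: (lspan_sub hN) => _ [j [m [_ Nm ->]]]; exact: lN.
  apply: Nmin hM sMN _.
  by move=> MX; apply: nX; apply: MX; apply: sub_lspan; exists i, n.
pose P : set C := [set c | exists j, [/\ I j, K j & c = hitl j v]].
have hP : is_subspace P.
  apply: (@is_subspace_nonempty _ _ 0).
    exists (lincomb (-1) i i); rewrite hitl_null; split=> //; first exact: Ilin.
    by move=> u _; rewrite hitl_null; exact: hX.1.
  move=> a _ _ [j [Ij Kj ->]] [j' [Ij' Kj' ->]]; exists (lincomb a j j').
  by rewrite hitl_lincomb; split; [exact: Ilin | exact: Klin |].
(* N = IN = I(Kv) lies in (I ∩ K)v, since [I] is a right ideal and [K] a left ideal. *)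
have NP : N `<=` P.
  rewrite -{1}MN; apply: (lspan_sub hP) => _ [j [m [Ij Nm ->]]].
  move: Nm; rewrite -KvN => -[f [Kf ->]]; exists (conv j f); rewrite hitlA.
  split=> //; first exact: (Imul f j Ij).2.
  by move=> u us; rewrite -hitlA; apply/lX/Kf.
(* The correction [i1] acts on [v] as [b] does and sends the earlier vectors into [X]. *)
have [i1 [Ii1 Ki1 i1E]] := NP _ (lN b v Nv).
exists (lincomb 1 i1 i0); split=> [|u]; first exact: Ilin.
rewrite hitl_lincomb scale1r -addrA inE => /predU1P[->|us].
  by rewrite -i1E bE addNr; exact: hX.1.
by apply: (subspace_add hX); [exact: Ki1 | exact: i0P].
Qed.

Lemma simple_subcoalg_ex D c (s : seq C) : is_subcoalg D -> D `<=` fspan s ->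
  D c -> c <> 0 -> exists E, is_simple_subcoalg E /\ E `<=` D.
Proof.
move=> hD Ds Dc c0.
pose F E := [/\ is_subcoalg E, E `<=` D & E <> [set 0]].
have n0 E x : E x -> x <> 0 -> E <> [set 0] by move=> Ex x0 e; apply: x0; rewrite e in Ex.
have [||E [[hE ED E0] Emin]] := @fspan_minimal _ _ s F.
- by move=> E [hE ED _]; split; [exact: hE.1 | exact: subset_trans ED Ds].
- by exists D; split=> //; exact: n0 Dc c0.
exists E; split=> //; split=> // E' hE' E'E.
have [->|nE'] := EM (E' = [set 0]); first by left.
by right; apply: Emin => //; split=> //; exact: subset_trans E'E ED.
Qed.

(** If the counit vanished on [E], then f(e) = ε(e ↼ f) would be 0 for every functional f. *)
Lemma subcoalg_counit_neq0 E : is_subcoalg E -> E <> [set 0] ->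
  exists e, E e /\ counit e <> 0.
Proof.
move=> /subcoalgP[hE lE rE] E0; apply: contrapT => nex; apply: E0.
apply/seteqP; split=> [e Ee|_ ->]; last exact: hE.1.
apply: scalar_eq0 => f; rewrite -[e]hitl_counit hit_swap.
by apply: contrapT => h; apply: nex; exists (hitr f e); split=> //; exact: rE.
Qed.

(** The C*-sub-bimodule generated by [c], hence the smallest subcoalgebra containing it. *)
Definition gen_subcoalg c : set C :=
  lspan [set x | exists f g, x = hitl f (hitr g c)].

Lemma is_subcoalg_gen c : is_subcoalg (gen_subcoalg c).
Proof.
have hD := is_subspace_lspan [set x | exists f g, x = hitl f (hitr g c)].
apply/subcoalgP; split=> // f.
  apply: (lspan_sub (M := hitl f @^-1` gen_subcoalg c)).
    by apply: is_subspace_preim => //; exact: hitl_linear.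
  by move=> _ [g [h ->]]; apply: sub_lspan; exists (conv f g), h; rewrite hitlA.
apply: (lspan_sub (M := hitr f @^-1` gen_subcoalg c)).
  by apply: is_subspace_preim => //; exact: hitr_linear.
move=> _ [g [h ->]]; apply: sub_lspan; exists g, (conv h f).
by rewrite -hitlrC hitrA.
Qed.

Lemma gen_subcoalg_mem c : gen_subcoalg c c.
Proof. by apply: sub_lspan; exists counit, counit; rewrite hitl_counit hitr_counit. Qed.

(** With the two lemmas above, this is the finiteness theorem for coalgebras: every element lies in
    a finite-dimensional subcoalgebra. *)
Lemma gen_subcoalg_fspan c : exists s, gen_subcoalg c `<=` fspan s.
Proof.
have [s hs] := hitlr_fspan c; exists s.
by apply: lspan_sub; [exact: is_subspace_fspan | move=> _ [f [g ->]]; exact: hs].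
Qed.

Lemma minimal_left_submod X c : is_left_submod X -> ~ X c ->
  exists N s, [/\ is_left_submod N, N = fspan s, ~ N `<=` X &
    forall N', is_left_submod N' -> N' `<=` N -> ~ N' `<=` X -> N' = N].
Proof.
move=> hX nc; have [s hs] := hitl_fspan c.
pose F N := [/\ is_left_submod N, N `<=` fspan s & ~ N `<=` X].
have [||N [[hN Ns nNX] Nmin]] := @fspan_minimal _ _ s F.
- by move=> N [[hN _] Ns _].
(* The cyclic module C* ⇀ c is finite-dimensional and contains [c] through the counit. *)
- exists [set x | exists f, x = hitl f c]; split.
  + split=> [|f _ [g ->]]; last by exists (conv f g); rewrite hitlA.
    apply: (@is_subspace_nonempty _ _ c); first by exists counit; rewrite hitl_counit.
    by move=> a _ _ [f ->] [g ->]; exists (lincomb a f g); rewrite hitl_lincomb.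
  + by move=> _ [f ->].
  + by move=> /(_ c) h; apply: nc; apply: h; exists counit; rewrite hitl_counit.
have [t tE] := fspan_basis hN.1 Ns.
exists N, t; split=> // N' hN' N'N nN'X; apply: Nmin => //.
by split=> //; exact: subset_trans N'N Ns.
Qed.

Lemma wedge_closed_setT X : is_subcoalg X ->
  (forall D, is_simple_subcoalg D -> D `<=` X) -> wedge X X `<=` X -> X = [set: C].
Proof.
move=> cX simX wX; have [hX lX rX] := (subcoalgP X).1 cX.
apply/seteqP; split=> // c _; apply: contrapT => nc.
have hlX : is_left_submod X by [].
have [N [s [hN Ns nNX Nmin]]] := minimal_left_submod hlX nc.
have /existsNP[n /not_implyP[Nn nX]] := nNX.
apply/nX/wX; apply: tensor_wedge_contract => // f fX.
apply: contrapT => nfn.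
have [l [lX0 ln]] := scalar_separates hX nX.
(* [d] represents a coefficient of N/(N ∩ X): g(d) = l(g ⇀ n) for every g. It is nonzero because
   ε(d) = l(n) = 1. *)
pose d := hitr l n.
have d0 : d <> 0.
  move=> d0; have := hit_swap l counit n; rewrite hitl_counit -/d d0 ln linear0.
  by move/eqP; rewrite oner_eq0.
have [t Dt] := gen_subcoalg_fspan d.
have [E [simE ED]] :=
  simple_subcoalg_ex (is_subcoalg_gen d) Dt (@gen_subcoalg_mem d) d0.
have [cE E0 _] := simE; have [hE lE rE] := (subcoalgP E).1 cE.
have EX := simX _ simE.
(* The annihilator of [E] is a two-sided ideal because [E] is a sub-bimodule. It contains [f], as
   [E] lies in [X], and so does not send [N] into [X]. *)
pose I : set {scalar C} := [set g | forall e, E e -> g e = 0].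
have [|||v|i [Ii iP]] := @ideal_dense X N I s counit hlX hN Nmin.
- by move=> a i j Ii Ij e Ee; rewrite lincombE Ii // Ij // mulr0 addr0.
- move=> g i Ii; split=> e Ee; last by rewrite convEl; apply/Ii/lE.
  by rewrite convEl hit_swap; apply/Ii/rE.
- by exists f, n; split=> // e Ee; apply/fX/EX.
- by rewrite Ns; exact: fspan_mem.
have iN m : N m -> X (hitl i m - m).
  rewrite Ns; move: m; apply: fspan_sub => [|m ms].
    split=> [|a x y hx hy].
      by rewrite (linear0_fun (hitl_linear i)) subrr; exact: hX.1.
    by rewrite hitl_linear opprD addrACA -scalerBr; exact: hX.2.
  by have := iP m ms; rewrite hitl_counit.
(* i agrees with the counit on the subcoalgebra generated by d = n ↼ l, because
   it acts as the identity on N modulo X and l vanishes on X. *)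
have iD : gen_subcoalg d `<=` [set e | i e - counit e = 0].
  apply: lspan_sub.
    split=> [|a x y /= hx hy]; first by rewrite /= !linear0 subrr.
    by rewrite !linearP opprD addrACA -mulrBr hx hy mulr0 addr0.
  move=> _ [g [h ->]] /=.
  have jE (j : {scalar C}) : j (hitl g (hitr h d)) = l (hitl h (hitl j (hitl g n))).
    by rewrite /d hitrA hitlrC -hit_swap convEl.
  rewrite !jE hitl_counit -linearB lX0 // addrC -scaleN1r -hitl_linear scaleN1r addrC.
  by apply: lX; apply: iN; apply: hN.2.
have [e [Ee]] := subcoalg_counit_neq0 cE E0.
by apply; have /eqP := iD e (ED e Ee); rewrite Ii // sub0r oppr_eq0 => /eqP.
Qed.

End CoradicalWedge.

(** * Generated submodule coalgebras and the radical *)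

Section RadicalClass.
Variables (k : fieldType) (B : bialgType k).
Implicit Types (C : modCoalgType B).

Lemma is_submod_gen C (D : set C) : is_submod (submod_gen D).
Proof.
split=> [|x b hx M hM]; last by apply: hM.1.2; exact: hx.
split=> [M [hM _]|a x y hx hy M hM]; first exact: hM.1.1.
by apply: hM.1.1.2; [exact: hx | exact: hy].
Qed.

Lemma sub_submod_gen C (D : set C) : D `<=` submod_gen D.
Proof. exact: sub_smallest. Qed.

Lemma tensor_sub_act C (M : set C) (t : (C ⊗ C)%type) (s : (B ⊗ B)%type) :
  is_submod M -> tensor_sub M M t -> tensor_sub M M (tmap2 act act t s).
Proof.
move=> [hM aM].
have ab : bilinear_map (act : C -> B -> C) by exact: act_bilinear.
have [tl tr] := tmap2_bilinear ab ab.
have hT := is_subspace_tensor_sub M M.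
move: t; apply: (tensor_sub_min (M := (fun t => tmap2 act act t s) @^-1` tensor_sub M M)).
  exact: is_subspace_preim (tl s) hT.
move=> x y Mx My /=; rewrite [s]tensor_sum (linear_sum_fun (tr _)).
apply: (is_subspace_sum hT) => p; rewrite (tmap2E ab ab).
by apply: tensor_sub_tens; exact: aM.
Qed.

(** Since Δ is a B-module map, the elements with coproduct in DB ⊗ DB form a submodule; it contains
    [D], hence DB. *)
Lemma is_submodcoalg_gen C (D : set C) :
  is_subcoalg D -> is_submodcoalg (submod_gen D).
Proof.
move=> [hD cD]; have hM := is_submod_gen D; split=> //; split; first exact: hM.1.
have hT := is_subspace_tensor_sub (submod_gen D) (submod_gen D).
apply: (smallest_sub (X := comul @^-1` tensor_sub (submod_gen D) (submod_gen D))).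
  split=> [|x b /= hx]; last by rewrite comul_act; apply: tensor_sub_act.
  by apply: is_subspace_preim => // a x y; rewrite linearP.
by move=> x /cD; apply: tensor_sub_subset; exact: sub_submod_gen.
Qed.

Lemma submodcoalg_setT C : is_submodcoalg [set: C].
Proof.
split; last by [].
split=> // x _; rewrite [comul x]tensor_sum.
apply: is_subspace_sum (is_subspace_tensor_sub _ _) _ _ _ _ => p.
exact: tensor_sub_tens.
Qed.

Variables (R : coalg_class B) (hR : idempotent_radical_class R).

Lemma Rcoalg_coradical C (X : set C) :
  is_Rsubcoalg R X -> coradical C `<=` X -> R C.
Proof.
move=> RX corX.
pose I := {D : set C | is_Rsubcoalg R D}.
pose rad : set C := lspan (\bigcup_(i : I) sval i).
have Rrad : is_Rsubcoalg R rad by apply: (radical_sum hR) => -[].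
have radM (D : set C) : is_Rsubcoalg R D -> D `<=` rad.
  by move=> RD x Dx; apply: sub_lspan; exists (exist _ D RD).
have radT : rad = [set: C].
  apply: wedge_closed_setT; first by case: Rrad => -[].
    move=> D simD; apply: (subset_trans _ (radM _ RX)) => x Dx.
    by apply: corX; apply: sub_lspan; exists D.
  (* By (R3), [rad] ∧ [rad] is one of the summands of [rad]. *)
  by apply: radM; apply: (idempotent_wedge hR).
(* Here [R] is known only for the improper subobject, a different type from [C]; [coalg_class_full]
   passes to [C]. *)
by have := Rrad; rewrite radT => -[hC]; exact: coalg_class_full.
Qed.

End RadicalClass.

Theorem proposition2p5 (k : fieldType) (B : bialgType k) (R : coalg_class B)
    (hR : idempotent_radical_class R) (C : modCoalgType B) :
  [<-> R C;
       exists C' : set C, is_Rsubcoalg R C' /\ coradical C `<=` C';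
       forall D : set C, is_simple_subcoalg D -> is_Rsubcoalg R (submod_gen D)].
Proof.
tfae.
- move=> RC; exists [set: C]; split=> //.
  exact: (radical_sub hR RC (submodcoalg_setT C)).
(* This goes through (i): once [C] is in [R], (R1) applies to DB. *)
- move=> [C' [RC' corC']] D [cD _ _]; apply: (radical_sub hR).
    exact: Rcoalg_coradical RC' corC'.
  exact: is_submodcoalg_gen.
- move=> RD.
  pose I := {D : set C | is_simple_subcoalg D}.
  (* The sum of all the DB is an R-subcoalgebra by (R2), and it contains the coradical. *)
  apply: (@Rcoalg_coradical _ _ _ hR _ (lspan (\bigcup_(i : I) submod_gen (sval i)))).
    by apply: (radical_sum hR) => -[D simD]; exact: RD.
  apply: lspan_subset => x [D simD Dx].
  by exists (exist _ D simD) => //; exact: sub_submod_gen.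
Qed.
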